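(* Under the setting below, every nonzero element $\bar x$ of $\mathcal C$ satisfies $\sum_{i=1}^r\bar x_i=\frac12(n-1)$. Equivalently, after subtracting a constant from the superpotential $u$ (which removes $0$ from $\mathcal C$ and leaves a superpotential), $\mathcal C$ lies in the hyperplane $\{\bar x:\sum_i\bar x_i=\frac12(n-1)\}$.
   Context: Let $G$ be a compact Lie group, $K\subset G$ a closed subgroup with $G/K$ connected and almost effective, and $\mathfrak p=\mathfrak p_1\oplus\cdots\oplus\mathfrak p_r$ ($r\ge2$) an $\mathrm{Ad}(K)$-invariant decomposition of the isotropy representation into pairwise inequivalent $\mathbb R$-irreducible summands; $d_i=\dim\mathfrak p_i$, $d=(d_1,\dots,d_r)$, $n=\sum d_i$. For $q\in\mathbb R^r$ the $G$-invariant metric equal to $e^{q_i}Q$ on $\mathfrak p_i$ ($Q$ fixed bi-invariant) has scalar curvature $S(q)=\sum_{w\in\mathcal W}A_we^{w\cdot q}$ with $\mathcal W\subset\mathbb Z^r$ finite and constants $A_w\ne0$; each $w\in\mathcal W$ is of type I (one entry $-1$, rest $0$), type II (one entry $1$, two entries $-1$, rest $0$) or type III (one entry $1$, one entry $-2$, rest $0$), and $A_w>0$ for type I, $A_w<0$ for types II, III. Assume $\dim\operatorname{conv}(\mathcal W)=r-1$. $J$ is the symmetric bilinear form on $\mathbb R^r$ with $J(p,p)=\frac1{n-1}(\sum p_i)^2-\sum p_i^2/d_i$. Assume $u(q)=\sum_{\bar c\in\mathcal C}F_{\bar c}e^{\bar c\cdot q}$ ($\mathcal C\subset\mathbb R^r$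 finite, $F_{\bar c}\neq0$) is a superpotential, i.e. $J(\nabla u,\nabla u)=e^{d\cdot q}S(q)$; equivalently, for every $\xi\in\mathbb R^r$, $\sum_{(\bar a,\bar c)\in\mathcal C\times\mathcal C,\ \bar a+\bar c=\xi}J(\bar a,\bar c)F_{\bar a}F_{\bar c}$ equals $A_w$ if $\xi=d+w$ with $w\in\mathcal W$ and $0$ otherwise. *)

(* Defs.v *)
From HB Require Import structures.
From mathcomp Require Import all_boot all_order all_algebra.
Set Implicit Arguments. Unset Strict Implicit. Unset Printing Implicit Defensive.
Import Order.TTheory GRing.Theory Num.Theory.
Local Open Scope ring_scope.

Section Defs.
Variables (R : realFieldType) (r : nat).

Definition evec (i : 'I_r) : 'rV[R]_r := \row_j (if j == i then 1 else 0).

Definition typeI (w : 'rV[R]_r) : Prop := exists i, w = - evec i.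
Definition typeII (w : 'rV[R]_r) : Prop :=
  exists i j k, [/\ i != j, i != k, j != k & w = evec i - evec j - evec k].
Definition typeIII (w : 'rV[R]_r) : Prop :=
  exists i j, i != j /\ w = evec i - 2 *: evec j.

Definition vsum (p : 'rV[R]_r) : R := \sum_i p 0 i.

Definition dvec (d : 'I_r -> nat) : 'rV[R]_r := \row_i (d i)%:R.
Definition ndim (d : 'I_r -> nat) : nat := (\sum_i d i)%N.

Definition Jform (d : 'I_r -> nat) (p q : 'rV[R]_r) : R :=
  vsum p * vsum q / ((ndim d)%:R - 1) - \sum_i p 0 i * q 0 i / (d i)%:R.

(* affine dimension of (the convex hull of) a finite set of points
   = rank of the differences w - w0, w in W ; -1 conventionally for empty W *)
Definition affdim (W : seq 'rV[R]_r) : int :=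
  match W with
  | [::] => -1
  | w0 :: _ => (\rank (\matrix_(k < size W) (W`_k - w0)))%:Z
  end.

End Defs.

(* Main.v *)
(** Call [xi] "level" the functional [sum_i xi_i - (n-1)/2]; the sums [a + c] of exponents that
    survive in [J(grad u, grad u)] have levels adding up to zero. On differences of vectors
    of equal level [J] is negative definite. This forces a set of exponents of extreme nonzero
    level to be a single null vector. If [a] is a nonzero exponent of maximal [|level| = m > 0], the
    edges of [conv C] at [a] that are not [J]-orthogonal to [a] can only end at the unique
    exponent [b] of level [-m]. Maximising [J(a,.) + J(b,.)] over the remaining exponents then
    shows that all of them are orthogonal to both [a] and [b]. Hence [J(a - b, .)] vanishes on
    [d + W], which spans [R^r], and [a = b] because [J] is nondegenerate: a contradiction. *)
Require Import Defs.
From HB Require Import structures.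
From mathcomp Require Import all_boot all_order all_algebra.
From mathcomp Require Import ring lra.
Import Order.TTheory GRing.Theory Num.Theory.
Local Open Scope ring_scope.

Lemma seq_argmax (R : realDomainType) (T : eqType) (s : seq T) (P : pred T) (f : T -> R) x0 :
  x0 \in s -> P x0 ->
  exists x, [/\ x \in s, P x & forall y, y \in s -> P y -> f y <= f x].
Proof.
elim: s x0 => [//|z s IH] x0 x0s Px0.
have [/hasP[y ys Py]|/hasPn sN] := boolP (has P s); last first.
  have x0z : x0 = z.
    by move: x0s; rewrite inE => /orP[/eqP//|/sN]; rewrite Px0.
  exists x0; split=> // y; rewrite inE x0z => /orP[/eqP->//|/sN/negP nPy /nPy//].
have [x [xs Px xmax]] := IH y ys Py.
have [/andP[Pz fxz]|zx] := boolP (P z && (f x <= f z)).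
  exists z; split; rewrite ?mem_head// => t; rewrite inE => /orP[/eqP->//|ts Pt].
  exact: le_trans (xmax t ts Pt) fxz.
exists x; split; rewrite ?inE ?xs ?orbT// => t /[!inE]/orP[/eqP-> Pz|/xmax//].
by move: zx; rewrite Pz /= -ltNge => /ltW.
Qed.

(** * Finite exponent sets with a bilinear form and a level *)

Section Exponents.
Context {R : realFieldType} {V : zmodType}.
Implicit Types (C : seq V) (K J : V -> V -> R) (l : V -> R).

(** Phrased through sums of two points because [V] has no scalars; it covers additive maps shifted
    by a constant, such as the level. *)
Definition affine l := forall x y x' y', x + y = x' + y' -> l x + l y = l x' + l y'.

(** This excludes cancellation: the coefficient of J(grad u, grad u) at [a + c] is J(a,c) F_a F_c,
    doubled when [a] and [c] differ. *)
Definition isolated C a c := forall x y, x \in C -> y \in C -> x + y = a + c ->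
  (x = a /\ y = c) \/ (x = c /\ y = a).

(** What is kept of the superpotential identity: an uncancelled term sits at some d + w, where the
    levels add up to zero. *)
Definition level_rule C K l := forall a c, a \in C -> c \in C ->
  isolated C a c -> K a c != 0 -> l a + l c = 0.

Lemma affineN l : affine l -> affine (fun x => - l x).
Proof. by move=> lA x y x' y' /lA; lra. Qed.

Lemma level_ruleN C K l : level_rule C K l -> level_rule C K (fun x => - l x).
Proof. by move=> H a c aC cC iso /(H a c aC cC iso); lra. Qed.

Lemma level_ruleNK C K l : level_rule C K l -> level_rule C (fun x y => - K x y) l.
Proof. by move=> H a c aC cC iso; rewrite oppr_eq0; apply: H. Qed.

(** Take [p] of least J(p,p) on the top level. By the parallelogram identity 2p is isolated, so
    J(p,p) = 0 since [0 < m]. Then J(p,c) > 0 for every other top exponent [c], and a [q] of least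
    J(p,q) would make [p + q] isolated, again impossible. *)
Lemma extreme_level_null C J l (m : R) :
  (forall x y, J x y = J y x) -> (forall x y z, J x (y + z) = J x y + J x z) ->
  affine l -> (forall x y, l x = l y -> x != y -> J (x - y) (x - y) < 0) ->
  level_rule C J l -> 0 < m -> (forall c, c \in C -> l c <= m) ->
  forall a, a \in C -> l a = m ->
  J a a = 0 /\ forall c, c \in C -> l c = m -> c = a.
Proof.
move=> JC JD lA Jneg rule m0 lm a aC la.
have JDl x y z : J (x + y) z = J x z + J y z by rewrite JC JD !(JC z).
have J0 x : J x 0 = 0 by have := JD x 0 0; rewrite addr0; lra.
have JN x y : J x (- y) = - J x y by have := JD x y (- y); rewrite subrr J0; lra.
have JNl x y : J (- x) y = - J x y by rewrite JC JN JC.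
have Jsub x y : J (x - y) (x - y) = J x x + J y y - 2 * J x y.
  by rewrite JD !JDl !JN !JNl (JC y x); ring.
have top x y x' y' : x \in C -> y \in C -> l x' = m -> l y' = m -> x + y = x' + y' ->
    l x = m /\ l y = m.
  by move=> /lm ? /lm ? ? ? /lA; split; lra.
have [p [pC /eqP lp pmin]] :=
  @seq_argmax R V C (fun x => l x == m) (fun x => - J x x) a aC (introT eqP la).
have Jpp : J p p = 0.
  apply/eqP/negPn/negP => Jn; suff : l p + l p = 0 by lra.
  apply: rule => // x y xC yC xy.
  have [lx ly] := top _ _ _ _ xC yC lp lp xy.
  have [xey|nxy] := eqVneq x y; last first.
    exfalso.
    have := Jneg x y (etrans lx (esym ly)) nxy.
    have /eqP lx' := lx; have /eqP ly' := ly.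
    have := pmin x xC lx'; have := pmin y yC ly'.
    have : J (x + y) (x + y) = J (p + p) (p + p) by rewrite xy.
    by rewrite Jsub !JD !JDl (JC y x); lra.
  (* [V] may have 2-torsion, so 2x = 2p does not give x = p at once; but J(x - p, x - p) equals its
     own negative, against definiteness. *)
  have xp : x - p = - (x - p).
    by rewrite opprB; apply/eqP; rewrite subr_eq addrAC eq_sym subr_eq -xy xey.
  have [xp'|nxp] := eqVneq x p; first by left; rewrite -xey.
  exfalso; have := Jneg x p (etrans lx (esym lp)) nxp.
  suff : J (x - p) (x - p) = - J (x - p) (x - p) by lra.
  by rewrite {2}xp JN.
have Jpos c : c \in C -> l c = m -> c != p -> 0 < J p c.
  move=> cC lc cp; have := Jneg c p (etrans lc (esym lp)) cp.
  have /eqP lc' := lc; have := pmin c cC lc'.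
  by rewrite Jsub (JC c p); lra.
have single c : c \in C -> l c = m -> c = p.
  move=> cC lc; apply/eqP/negPn/negP => ncp.
  have Pc : (l c == m) && (c != p) by rewrite lc eqxx.
  have [q [qC /andP[/eqP lq qp] qmin]] :=
    @seq_argmax R V C (fun x => (l x == m) && (x != p)) (fun x => - J p x) c cC Pc.
  have Jpq := Jpos q qC lq qp.
  suff : l p + l q = 0 by lra.
  apply: rule => //; last by rewrite gt_eqF.
  move=> x y xC yC xy.
  have [lx ly] := top _ _ _ _ xC yC lp lq xy.
  have [xp|nxp] := eqVneq x p.
    by left; split=> //; move: xy; rewrite xp => /addrI.
  have [yp|nyp] := eqVneq y p.
    by right; split=> //; move: xy; rewrite yp addrC => /addrI.
  exfalso; have := qmin x xC; have := qmin y yC; rewrite lx ly nxp nyp eqxx.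
  move=> /(_ isT) ? /(_ isT) ?.
  have : J p (x + y) = J p (p + q) by rewrite xy.
  by rewrite !JD; lra.
by rewrite (single a aC la); split=> // c /single H /H.
Qed.

(* [c] maximises the slope of [K a] along the rays from [a]; among all such [c] the one nearest
   to [a] spans with [a] an edge of the convex hull, so [a + c] is isolated. *)
Lemma edge_to_opposite C K l (m : R) a :
  affine (K a) -> affine l -> level_rule C K l -> 0 < m ->
  (forall c, c \in C -> - m <= l c <= m) ->
  a \in C -> l a = m -> (forall c, c \in C -> l c = m -> c = a) -> K a a = 0 ->
  (forall b c, b \in C -> c \in C -> l b = - m -> l c = - m -> c = b) ->
  forall c0, c0 \in C -> 0 < K a c0 ->
  exists b, [/\ b \in C, l b = - m, 0 < K a b &
    forall c, c \in C -> c != a -> c != b -> K a c * (2 * m) < K a b * (m - l c)].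
Proof.
move=> KA lA rule m0 lm aC la auniq Kaa buniq c0 c0C Kc0.
have lt_m c : c \in C -> c != a -> 0 < m - l c.
  move=> cC ca; have /andP[_] := lm c cC.
  rewrite le_eqVlt => /orP[/eqP/(auniq c cC) cea|]; last lra.
  by rewrite cea eqxx in ca.
have c0a : c0 != a by apply/eqP => c0a; move: Kc0; rewrite c0a Kaa ltxx.
have [c1 [c1C c1a c1max]] :=
  @seq_argmax R V C (fun x => x != a) (fun x => K a x / (m - l x)) c0 c0C c0a.
set k := K a c1 / (m - l c1) in c1max.
have k0 : 0 < k.
  by apply: lt_le_trans (c1max c0 c0C c0a); rewrite divr_gt0 ?lt_m.
have slope c : c \in C -> K a c <= k * (m - l c).
  move=> cC; have [->|ca] := eqVneq c a; first by rewrite Kaa la subrr mulr0.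
  by rewrite -ler_pdivrMr ?lt_m// c1max.
have c1face : K a c1 = k * (m - l c1).
  by rewrite /k mulfVK// gt_eqF ?lt_m.
have Pc1 : (c1 != a) && (K a c1 == k * (m - l c1)) by rewrite c1a -c1face eqxx.
have [b [bC /andP[ba /eqP bface] bmax]] :=
  @seq_argmax R V C (fun x => (x != a) && (K a x == k * (m - l x))) l c1 c1C Pc1.
have Kab : 0 < K a b by rewrite bface mulr_gt0 ?lt_m.
have lb : l b = - m.
  suff : l a + l b = 0 by lra.
  apply: rule => //; last by rewrite gt_eqF.
  move=> x y xC yC xy.
  have [xa|nxa] := eqVneq x a; first by left; split=> //; move: xy; rewrite xa => /addrI.
  have [ya|nya] := eqVneq y a.
    by right; split=> //; move: xy; rewrite ya addrC => /addrI.
  (* Both slope bounds are tight, so [x] and [y] lie on the face and have level at most [l b]; yet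
     their levels add up to m + l b > 2 l b. *)
  exfalso; have lxy := lA _ _ _ _ xy; have Kxy := KA _ _ _ _ xy.
  have sx := slope x xC; have sy := slope y yC.
  have kxy : k * (m - l x) + k * (m - l y) = K a x + K a y.
    by rewrite Kxy Kaa bface -mulrDr add0r; congr (k * _); lra.
  have /bmax : x \in C := xC; rewrite nxa /=.
  have -> : K a x == k * (m - l x) by apply/eqP; lra.
  have /bmax : y \in C := yC; rewrite nya /=.
  have -> : K a y == k * (m - l y) by apply/eqP; lra.
  by have := lt_m b bC ba => ? /(_ isT) ? /(_ isT) ?; lra.
exists b; split=> // c cC ca cb.
have -> : K a b * (m - l c) = k * (m - l c) * (2 * m) by rewrite bface lb; ring.
rewrite ltr_pM2r; last by lra.
(* Equality would put [c] on the face, hence at level at most [l b = - m], where [b] is the only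
   exponent. *)
rewrite lt_neqAle slope// andbT; apply/negP => cface.
have := bmax c cC; rewrite ca cface => /(_ isT); rewrite lb => lcm.
by move/negP: cb; apply; apply/eqP/(buniq b c) => //; have /andP[? _] := lm c cC; lra.
Qed.

(** A negative value would give, by the edge argument for -K, an exponent of level [- m] with K(a,.)
    negative; but that exponent is [b]. *)
Lemma edge_to_opposite_ge0 C K l (m : R) a :
  affine (K a) -> affine l -> level_rule C K l -> 0 < m ->
  (forall c, c \in C -> - m <= l c <= m) ->
  a \in C -> l a = m -> (forall c, c \in C -> l c = m -> c = a) -> K a a = 0 ->
  (forall b c, b \in C -> c \in C -> l b = - m -> l c = - m -> c = b) ->
  forall b, b \in C -> l b = - m -> 0 < K a b -> forall c, c \in C -> 0 <= K a c.
Proof.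
move=> KA lA rule m0 lm aC la auniq Kaa buniq b bC lb Kab c cC.
rewrite leNgt; apply/negP => Kac.
have Kac' : 0 < - K a c by lra.
have Kaa' : - K a a = 0 by rewrite Kaa oppr0.
have [b' [b'C lb' Kab' _]] := @edge_to_opposite C (fun x y => - K x y) l m a
  (affineN _ KA) lA (level_ruleNK _ _ _ rule) m0 lm aC la auniq Kaa' buniq c cC Kac'.
by move: Kab'; rewrite (buniq b b' bC b'C lb lb'); lra.
Qed.

(** Let [c] maximise K(a,.) + K(b,.) outside {a, b}. If K(a,c) is nonzero, [a + c] is isolated, so
    [c] has level [- m] and equals [b]; symmetrically K(b,c) = 0. The maximum is thus 0, and
    nonnegativity does the rest. *)
Lemma orthogonal_to_edge C K l (m : R) a b :
  (forall x y, K x y = K y x) -> (forall x, affine (K x)) -> affine l -> level_rule C K l ->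
  0 < m -> a \in C -> b \in C -> l a = m -> l b = - m ->
  (forall c, c \in C -> l c = m -> c = a) -> (forall c, c \in C -> l c = - m -> c = b) ->
  K a a = 0 -> K b b = 0 -> 0 < K a b ->
  (forall c, c \in C -> 0 <= K a c) -> (forall c, c \in C -> 0 <= K b c) ->
  (forall c, c \in C -> c != a -> c != b -> K a c + K b c < K a b) ->
  forall c, c \in C -> c != a -> c != b -> K a c = 0 /\ K b c = 0.
Proof.
move=> KC KA lA rule m0 aC bC la lb auniq buniq Kaa Kbb Kab Ka Kb Klt c0 c0C c0a c0b.
have Pc0 : (c0 != a) && (c0 != b) by rewrite c0a.
have [c [cC /andP[ca cb] cmax]] :=
  @seq_argmax R V C (fun x => (x != a) && (x != b)) (fun x => K a x + K b x) c0 c0C Pc0.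
have Kba := KC b a.
have cmax' x : x \in C -> x != a -> x != b -> K a x + K b x <= K a c + K b c.
  by move=> xC xa xb; apply: cmax; rewrite ?xa.
have Kc := Klt c cC ca cb.
have Mle x : x \in C -> K a x + K b x <= K a b.
  move=> xC; have [->|xa] := eqVneq x a; first lra.
  by have [->|xb] := eqVneq x b; [lra | exact/ltW/Klt].
(* Hence [a + c = b + y] is impossible: it forces [K b y >= K a b]. *)
have trade y : y \in C -> y != a -> y != b -> K a b <= K a y -> False.
  by move=> yC ya yb ?; have := Klt y yC ya yb; have := Kb y yC; lra.
have trade' y : y \in C -> y != a -> y != b -> K a b <= K b y -> False.
  by move=> yC ya yb ?; have := Klt y yC ya yb; have := Ka y yC; lra.
(* Here [e] is [a] or [b]. Outside {a, b} the values at [x] and [y] add up to at most twice the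
   value at [c], less than K(a,b) plus that value. *)
have far x y e : x \in C -> y \in C -> K a e + K b e = K a b -> x + y = e + c ->
    [\/ x = a, x = b, y = a | y = b].
  move=> xC yC Me xy.
  have [|xa] := eqVneq x a; first by constructor 1.
  have [|xb] := eqVneq x b; first by constructor 2.
  have [|ya] := eqVneq y a; first by constructor 3.
  have [|yb] := eqVneq y b; first by constructor 4.
  exfalso; have := cmax' x xC xa xb; have := cmax' y yC ya yb.
  by have := KA a _ _ _ _ xy; have := KA b _ _ _ _ xy; lra.
have Kac : K a c = 0.
  apply/eqP/negPn/negP => Kac.
  have /eqP := cb; apply; apply: buniq => //.
  suff : l a + l c = 0 by lra.
  apply: rule => // x y xC yC xy.
  have nob z : z \in C -> b + z = a + c -> False.
    move=> zC e; have e1 := KA a _ _ _ _ e; have e2 := KA b _ _ _ _ e.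
    have cC0 := Kb c cC; have za : z != a.
      by apply/eqP => za; move: e; rewrite za addrC => /addrI bc; rewrite bc eqxx in cb.
    apply: (trade' z) => //; last by lra.
    by apply/eqP => zb; move: e1 e2; rewrite zb; lra.
  case: (far x y a xC yC _ xy); rewrite ?Kaa ?Kba ?add0r// => E; rewrite E in xy.
  - by left; split=> //; apply: addrI xy.
  - by case: (nob y yC xy).
  - by right; split=> //; apply: addrI (etrans (addrC _ _) xy).
  - by case: (nob x xC (etrans (addrC _ _) xy)).
have Kbc : K b c = 0.
  apply/eqP/negPn/negP => Kbc.
  have /eqP := ca; apply; apply: auniq => //.
  suff : l b + l c = 0 by lra.
  apply: rule => // x y xC yC xy.
  have noa z : z \in C -> a + z = b + c -> False.
    move=> zC e; have e1 := KA a _ _ _ _ e; have e2 := KA b _ _ _ _ e.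
    have cC0 := Ka c cC; have zb : z != b.
      by apply/eqP => zb; move: e; rewrite zb addrC => /addrI ac; rewrite ac eqxx in ca.
    apply: (trade z) => //; last by lra.
    by apply/eqP => za; move: e1 e2; rewrite za; lra.
  case: (far x y b xC yC _ xy); rewrite ?Kbb ?addr0// => E; rewrite E in xy.
  - by case: (noa y yC xy).
  - by left; split=> //; apply: addrI xy.
  - by case: (noa x xC (etrans (addrC _ _) xy)).
  - by right; split=> //; apply: addrI (etrans (addrC _ _) xy).
have := cmax' c0 c0C c0a c0b; have := Ka c0 c0C; have := Kb c0 c0C.
by split; lra.
Qed.

(** The hypothesis on [p] carries the dimension condition on W. It serves twice: to find an exponent
    not orthogonal to [a], and to conclude that [a - b] vanishes. *)
Lemma exponents_level0 C J l :
  (forall x y, J x y = J y x) -> (forall x y z, J x (y + z) = J x y + J x z) ->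
  affine l -> (forall x y, l x = l y -> x != y -> J (x - y) (x - y) < 0) ->
  level_rule C J l -> 0 \notin C ->
  (forall p, (forall x y, x \in C -> y \in C -> J x y != 0 -> J p (x + y) = 0) -> p = 0) ->
  forall c, c \in C -> l c = 0.
Proof.
move=> JC JD lA Jneg rule C0 span c0 c0C; apply/eqP/negPn/negP => lc0.
have JA x : affine (J x) by move=> y z y' z' e; rewrite -!JD e.
have [a [aC _ amax]] := @seq_argmax R V C predT (fun x => `|l x|) c0 c0C isT.
wlog la : l lA Jneg rule lc0 amax / 0 <= l a.
  move=> W; have [|lan] := leP 0 (l a); first exact: (W l).
  apply: (W (fun x => - l x)); rewrite ?oppr_eq0 ?oppr_ge0 ?ltW//.
  - exact: affineN.
  - by move=> x y /oppr_inj; apply: Jneg.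
  - exact: level_ruleN.
  - by move=> y; rewrite !normrN; apply: amax.
have [m lam] : exists m, l a = m by exists (l a).
have m0 : 0 < m.
  rewrite -lam -[l a]ger0_norm//; apply: lt_le_trans (amax c0 c0C isT).
  by rewrite normr_gt0.
have lm c : c \in C -> - m <= l c <= m.
  by move=> cC; rewrite -ler_norml -lam -[l a]ger0_norm// amax.
have lm' c : c \in C -> - m <= - l c <= m by move=> /lm; lra.
have topnull := @extreme_level_null C J l m JC JD lA Jneg rule m0
  (fun c cC => (elimT andP (lm c cC)).2).
have botnull b : b \in C -> l b = - m ->
    J b b = 0 /\ forall c, c \in C -> l c = - m -> c = b.
  move=> bC lb; have lb' : - l b = m by lra.
  have Jneg' x y : - l x = - l y -> x != y -> J (x - y) (x - y) < 0.
    by move=> /oppr_inj; apply: Jneg.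
  have [Jbb U] := @extreme_level_null C J (fun x => - l x) m JC JD (affineN _ lA) Jneg'
    (level_ruleN _ _ _ rule) m0 (fun c cC => (elimT andP (lm' c cC)).2) b bC lb'.
  by split=> // c cC lc; apply: U => //; lra.
have [Jaa auniq] := topnull a aC lam.
have buniq b c : b \in C -> c \in C -> l b = - m -> l c = - m -> c = b.
  by move=> bC cC lb lc; apply: (botnull b bC lb).2.
have [c1 c1C Jac1] : exists2 c, c \in C & J a c != 0.
  apply/hasP/negPn/negP => /hasPn Ja.
  have Ja0 c : c \in C -> J a c = 0 by move=> /Ja/negPn/eqP.
  move/negP: C0; apply; rewrite -(span a)// => x y xC yC _.
  by rewrite JD !Ja0// addr0.
(* [K] is J or -J, signed so that K(a,c1) > 0. The edge lemmas do not ask for definiteness, so this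
   is harmless. *)
have [K [KC KA Krule KJ Kc1]] : exists K : V -> V -> R,
    [/\ forall x y, K x y = K y x, forall x, affine (K x), level_rule C K l,
        forall x y, (K x y == 0) = (J x y == 0) & 0 < K a c1].
  case: (ltgtP (J a c1) 0) Jac1 => // Jac1 _; last by exists J.
  exists (fun x y => - J x y); split.
  - by move=> x y; rewrite JC.
  - by move=> x; apply: affineN.
  - exact: level_ruleNK.
  - by move=> x y; rewrite oppr_eq0.
  - by lra.
have Kaa : K a a = 0 by apply/eqP; rewrite KJ Jaa.
have [b [bC lb Kab Kslope]] := @edge_to_opposite C K l m a (KA a) lA Krule m0 lm aC lam
  auniq Kaa buniq c1 c1C Kc1.
have [Jbb buniq'] := botnull b bC lb.
have Kbb : K b b = 0 by apply/eqP; rewrite KJ Jbb.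
have lb' : - l b = m by lra.
have Kba : 0 < K b a by rewrite KC.
have bu' c : c \in C -> - l c = m -> c = b.
  by move=> cC lc; apply: buniq' => //; lra.
have au' x y : x \in C -> y \in C -> - l x = - m -> - l y = - m -> y = x.
  by move=> xC yC /oppr_inj lx /oppr_inj ly; rewrite (auniq x xC lx) (auniq y yC ly).
have Ka := @edge_to_opposite_ge0 C K l m a (KA a) lA Krule m0 lm aC lam auniq Kaa buniq
  b bC lb Kab.
have Kb := @edge_to_opposite_ge0 C K (fun x => - l x) m b (KA b) (affineN _ lA)
  (level_ruleN _ _ _ Krule) m0 lm' bC lb' bu' Kbb au' a aC (congr1 -%R lam) Kba.
(* With the level reversed, the edge from [b] leads back to [a] and supplies the second slope
   bound. *)
have [a' [a'C la' _ Kslope']] := @edge_to_opposite C K (fun x => - l x) m b (KA b)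
  (affineN _ lA) (level_ruleN _ _ _ Krule) m0 lm' bC lb' bu' Kbb au' a aC Kba.
have a'a : a' = a by apply: auniq => //; apply: oppr_inj.
(* Adding the slope bounds from both ends eliminates [l c]. *)
have Klt c : c \in C -> c != a -> c != b -> K a c + K b c < K a b.
  move=> cC ca cb; have s1 := Kslope c cC ca cb.
  have := Kslope' c cC cb; rewrite a'a => /(_ ca) s2.
  have m2 : 0 < 2 * m by lra.
  rewrite -(ltr_pM2r m2) mulrDl; rewrite (KC b a) in s2.
  have -> : K a b * (2 * m) = K a b * (m - l c) + K a b * (m - - l c) by ring.
  exact: ltrD.
have orth := @orthogonal_to_edge C K l m a b KC KA lA Krule m0 aC bC lam lb auniq buniq'
  Kaa Kbb Kab Ka Kb Klt.
have orthJ c : c \in C -> c != a -> c != b -> J a c = 0 /\ J b c = 0.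
  by move=> cC ca cb; have [] := orth c cC ca cb; split; apply/eqP; rewrite -KJ; apply/eqP.
have J0 x : J x 0 = 0 by have := JD x 0 0; rewrite addr0; lra.
have JN x y : J x (- y) = - J x y by have := JD x y (- y); rewrite subrr J0; lra.
have JBl x y z : J (x - y) z = J x z - J y z by rewrite JC JD JN !(JC z).
suff : a - b = 0 by move/subr0_eq => ab; move: lb; rewrite -ab lam; lra.
have Jba := JC b a.
(* If J(x,y) is nonzero, either {x, y} = {a, b}, where the terms cancel, or both lie outside and are
   orthogonal to [a] and [b]. *)
apply: span => x y xC yC Jxy; rewrite JBl !JD.
have [xa|xa] := eqVneq x a; have [ya|ya] := eqVneq y a.
- by move: Jxy; rewrite xa ya Jaa eqxx.
- have [->|yb] := eqVneq y b; first by rewrite xa; lra.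
  by move: Jxy; rewrite xa (orthJ y yC ya yb).1 eqxx.
- have [->|xb] := eqVneq x b; first by rewrite ya; lra.
  by move: Jxy; rewrite ya JC (orthJ x xC xa xb).1 eqxx.
- have [xb|xb] := eqVneq x b; have [yb|yb] := eqVneq y b.
  + by move: Jxy; rewrite xb yb Jbb eqxx.
  + by move: Jxy; rewrite xb (orthJ y yC ya yb).2 eqxx.
  + by move: Jxy; rewrite yb JC (orthJ x xC xa xb).2 eqxx.
  + have [-> ->] := orthJ x xC xa xb; have [-> ->] := orthJ y yC ya yb.
    by rewrite addr0 subrr.
Qed.

End Exponents.

(** * The form J: sign, duality and nondegeneracy *)

Section Jform.
Context {R : realFieldType} {r : nat} (d : 'I_r -> nat).
Hypotheses (r2 : (2 <= r)%N) (d0 : forall i, (0 < d i)%N).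
Implicit Types (p q : 'rV[R]_r).

Let J := @Jform R r d.
Let N : R := (ndim d)%:R - 1.

Lemma dim_gt1 : 0 < N.
Proof.
rewrite subr_gt0 ltr1n; apply: leq_trans r2 _.
by rewrite /ndim -[X in (X <= _)%N]card_ord -sum1_card leq_sum.
Qed.

Lemma dimr_neq0 i : (d i)%:R != 0 :> R.
Proof. by rewrite pnatr_eq0 -lt0n. Qed.

Lemma vsumD p q : vsum (p + q) = vsum p + vsum q.
Proof. by rewrite /vsum -big_split; apply: eq_bigr => i _; rewrite mxE. Qed.

Lemma vsum_dvec : vsum (dvec R d) = N + 1.
Proof.
rewrite /N subrK /ndim natr_sum; apply: eq_bigr => i _.
by rewrite mxE.
Qed.

Lemma JformC p q : J p q = J q p.
Proof.
rewrite /J /Jform [vsum p * _]mulrC; congr (_ - _).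
by apply: eq_bigr => i _; rewrite [p 0 i * _]mulrC.
Qed.

Lemma JformD p q q' : J p (q + q') = J p q + J p q'.
Proof.
rewrite /J /Jform vsumD mulrDr mulrDl -!addrA; congr (_ + _).
rewrite addrCA -opprD -big_split /=; congr (_ - _); apply: eq_bigr => i _.
by rewrite mxE mulrDr mulrDl.
Qed.

Lemma Jform_dvec p : J p (dvec R d) = vsum p / N.
Proof.
have N0 : N != 0 by rewrite gt_eqF ?dim_gt1.
rewrite /J /Jform vsum_dvec -/N.
have -> : \sum_i p 0 i * dvec R d 0 i / (d i)%:R = vsum p.
  by apply: eq_bigr => i _; rewrite mxE mulfK ?dimr_neq0.
by field.
Qed.

Lemma Jform_neg p : vsum p = 0 -> p != 0 -> J p p < 0.
Proof.
move=> p0 pn0; rewrite /J /Jform p0 mul0r mul0r sub0r oppr_lt0.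
have sq i : 0 <= p 0 i * p 0 i / (d i)%:R.
  by rewrite divr_ge0 ?ler0n// -expr2 sqr_ge0.
rewrite lt_neqAle sumr_ge0 ?andbT; last by move=> i _; apply: sq.
apply: contra pn0 => /eqP/esym/psumr_eq0P s0; apply/eqP/rowP => i; rewrite mxE.
have /eqP := s0 (fun i _ => sq i) i isT.
by rewrite mulf_eq0 invr_eq0 (negPf (dimr_neq0 i)) orbF mulf_eq0 orbb => /eqP.
Qed.

(** The column representing J(p,.) for the dot product, which turns orthogonality into a matrix
    kernel. *)
Definition Jdual p : 'cV[R]_r := \col_i (vsum p / N - p 0 i / (d i)%:R).

Lemma mul_Jdual p q : (q *m Jdual p) 0 0 = J p q.
Proof.
rewrite mxE /J /Jform -/N.
transitivity (\sum_i (vsum p / N * q 0 i - p 0 i * q 0 i / (d i)%:R)).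
  by apply: eq_bigr => i _; rewrite mxE; ring.
by rewrite sumrB -mulr_sumr -/(vsum q); congr (_ - _); ring.
Qed.

(* The differences of the [d + w] have rank [r - 1], so [J(p,.)] is a multiple [t] of the
   coordinate sum; that sum being [n - 1] on [d + w], [t] vanishes. *)
Lemma Jform_span (W : seq 'rV[R]_r) p :
  affdim W = (r%:Z - 1)%R -> (forall w, w \in W -> vsum w = - 1) ->
  (forall w, w \in W -> J p (dvec R d + w) = 0) -> p = 0.
Proof.
case: W => [|w0 W'].
  (* For empty [W] the conventional dimension -1 would mean r = 0. *)
  move=> /eqP; rewrite eq_sym subr_eq addNr => /eqP[rE]; exfalso.
  by move: r2; rewrite rE.
set W := w0 :: W' => dimW vW JW.
have [D rD rkD] : exists2 D : 'M[R]_(size W, r),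
    forall k, row k D = W`_k - w0 & (\rank D)%:Z = (r%:Z - 1)%R.
  by exists (\matrix_(k < size W) (W`_k - w0)) => // k; rewrite rowK.
have w0W : w0 \in W by rewrite mem_head.
pose one : 'cV[R]_r := const_mx 1.
have q1 q : (q *m one) 0 0 = vsum q.
  by rewrite mxE; apply: eq_bigr => i _; rewrite mxE mulr1.
have WkW (k : 'I_(size W)) : W`_k \in W by rewrite mem_nth.
have D0 (v : 'cV[R]_r) : (forall w, w \in W -> (w *m v) 0 0 = (w0 *m v) 0 0) -> D *m v = 0.
  move=> vE; apply/colP => k; rewrite [RHS]mxE.
  have -> : (D *m v) k 0 = (row k D *m v) 0 0 by rewrite -row_mul [RHS]mxE.
  by rewrite rD mulmxBl mxE [X in _ + X]mxE vE// subrr.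
have D1 : D *m one = 0 by apply: D0 => w wW; rewrite !q1 !vW.
have Dp : D *m Jdual p = 0.
  apply: D0 => w wW; rewrite !mul_Jdual.
  by have := JW w wW; have := JW w0 w0W; rewrite !JformD; lra.
have rkD' : r = (\rank D).+1.
  by move/eqP: rkD; rewrite eq_sym subr_eq -PoszD addn1 => /eqP[].
have k1 : (one^T <= kermx D^T)%MS by apply/sub_kermxP; rewrite -trmx_mul D1 trmx0.
have kp : ((Jdual p)^T <= kermx D^T)%MS by apply/sub_kermxP; rewrite -trmx_mul Dp trmx0.
have i0 : 'I_r by exact: Ordinal (ltnW r2).
have rk1 : \rank (one^T) = 1%N.
  apply/eqP; rewrite rank_rV; apply/eqP; rewrite -[RHS]/(nat_of_bool true); congr nat_of_bool.
  by apply/eqP => /rowP/(_ i0); rewrite !mxE => /eqP; rewrite oner_eq0.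
have keq : (kermx D^T <= one^T)%MS.
  have := mxrank_leqif_sup k1; rewrite mxrank_ker (mxrank_tr D) rk1 => -[_ <-].
  by rewrite [X in (X - _)%N]rkD' subSnn.
have [t tE] := sub_rVP (submx_trans kp keq).
have Jt q : J p q = t * vsum q.
  by rewrite -mul_Jdual -q1 -[Jdual p]trmxK tE linearZ /= trmxK -scalemxAr mxE.
have t0 : t = 0.
  have := JW w0 w0W; rewrite Jt vsumD vsum_dvec vW// addrK => /eqP.
  by rewrite mulf_eq0 (gt_eqF dim_gt1) orbF => /eqP.
(* Now J(p,.) = 0: pairing with d gives coordinate sum zero, where J is negative definite. *)
apply/eqP/negPn/negP => pn0.
have p0 : vsum p = 0.
  have := Jform_dvec p; rewrite Jt t0 mul0r => /esym/eqP.
  by rewrite mulf_eq0 invr_eq0 (gt_eqF dim_gt1) orbF => /eqP.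
by have := Jform_neg p p0 pn0; rewrite Jt t0 mul0r ltxx.
Qed.

End Jform.

(** * From the superpotential identity to the exponents *)

Lemma vsum_type (R : realFieldType) (r : nat) (w : 'rV[R]_r) :
  typeI w \/ typeII w \/ typeIII w -> vsum w = - 1.
Proof.
have vD (p q : 'rV[R]_r) : vsum (p + q) = vsum p + vsum q by exact: vsumD.
have vZ t (p : 'rV[R]_r) : vsum (t *: p) = t * vsum p.
  by rewrite /vsum mulr_sumr; apply: eq_bigr => i _; rewrite mxE.
have vN (p : 'rV[R]_r) : vsum (- p) = - vsum p by rewrite -scaleN1r vZ mulN1r.
have ve i : vsum (evec R i) = 1.
  rewrite /vsum (bigD1 i)//= mxE eqxx big1 ?addr0// => j ji.
  by rewrite mxE (negPf ji).
by case=> [[i ->]|[[i [j [k [_ _ _ ->]]]]|[i [j [_ ->]]]]];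
  rewrite ?vD ?vN ?vZ !ve; ring.
Qed.

Theorem theorem1p5 (R : realFieldType) (r : nat) (d : 'I_r -> nat)
    (W : seq 'rV[R]_r) (A : 'rV[R]_r -> R)
    (C : seq 'rV[R]_r) (F : 'rV[R]_r -> R) :
  (2 <= r)%N ->
  (forall i, (0 < d i)%N) ->
  uniq W ->
  (forall w, w \in W ->
     [/\ A w != 0,
         typeI w \/ typeII w \/ typeIII w,
         typeI w -> 0 < A w,
         typeII w -> A w < 0 &
         typeIII w -> A w < 0]) ->
  affdim W = (r%:Z - 1)%R ->
  uniq C ->
  (forall c, c \in C -> F c != 0) ->
  (* superpotential identity J(grad u, grad u) = e^{d.q} S(q), coefficientwise *)
  (forall xi : 'rV[R]_r,
     \sum_(a <- C) \sum_(c <- C | a + c == xi) @Jform R r d a c * F a * F c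
     = \sum_(w <- W | xi == @dvec R r d + w) A w) ->
  forall x, x \in C -> x != 0 -> vsum x = ((ndim d)%:R - 1) / 2.
Proof.
move=> r2 d0 uW HW dimW uC FC supi x xC x0.
set N : R := (ndim d)%:R - 1.
pose l (y : 'rV[R]_r) := vsum y - N / 2.
suff : l x = 0 by rewrite /l => /subr0_eq.
(* The exponent 0 is J-orthogonal to everything, so dropping it changes no coefficient. *)
pose C' := [seq c <- C | c != 0].
have JC := @JformC R r d; have JD := @JformD R r d.
have J0 (y : 'rV[R]_r) : Jform d y 0 = 0 by have := JD y 0 0; rewrite addr0; lra.
have vN (y z : 'rV[R]_r) : vsum (y - z) = vsum y - vsum z.
  by apply/eqP; rewrite eq_sym subr_eq -vsumD subrK.
have vW w : w \in W -> vsum w = - 1 by case/HW => _ /vsum_type.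
have xC' : x \in C' by rewrite mem_filter x0.
have rule : level_rule C' (Jform d) l.
  move=> a c; rewrite !mem_filter => /andP[a0 aC] /andP[c0 cC] iso Jac.
  (* A pair with nonzero J has no zero member, so isolation in [C'] extends to such pairs from
     [C]. *)
  have iso' y z : y \in C -> z \in C -> y + z = a + c -> Jform d y z != 0 ->
      (y = a /\ z = c) \/ (y = c /\ z = a).
    move=> yC zC yz Jyz; apply: iso => //; rewrite mem_filter ?yC ?zC andbT.
      by apply: contraNneq Jyz => ->; rewrite JC J0.
    by apply: contraNneq Jyz => ->; rewrite J0.
  have [/hasP[w wW /eqP E]|/hasPn noW] := boolP (has (fun w => a + c == dvec R d + w) W).
    have : vsum (a + c) = vsum (dvec R d + w) by rewrite E.
    by rewrite !vsumD vsum_dvec (vW w wW) /l /N; lra.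
  (* Off d + W the coefficient must vanish, yet it is J(a,c) F_a F_c times the number of exponents
     in {a, c}, which is positive whether or not a = c. *)
  exfalso; have := supi (a + c); rewrite [RHS]big_seq_cond [RHS]big1; last first.
    by move=> w /andP[/noW/negPf->].
  have inner y : y \in C -> \sum_(z <- C | y + z == a + c) Jform d y z * F y * F z
      = if (y == a) || (y == c) then Jform d a c * F a * F c else 0.
    move=> yC; have [ya|ya] := eqVneq y a; last have [yc|yc] := eqVneq y c => /=.
    - rewrite ya big_mkcond (bigD1_seq c)//= eqxx big1 ?addr0// => z zc.
      by rewrite (inj_eq (addrI _)) (negPf zc).
    - rewrite yc [a + c]addrC big_mkcond (bigD1_seq a)//= eqxx big1.
        by rewrite addr0 (JC c); ring.
      by move=> z za; rewrite (inj_eq (addrI _)) (negPf za).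
    - rewrite big_seq_cond big1// => z /andP[zC /eqP yz].
      have [->|Jyz] := eqVneq (Jform d y z) 0; first by rewrite !mul0r.
      by case: (iso' y z yC zC yz Jyz) => -[E _]; [move: ya|move: yc]; rewrite E eqxx.
  rewrite big_seq (eq_bigr _ inner) -big_seq -big_mkcond /= big_const_seq iter_addr_0.
  apply/eqP; rewrite mulrn_eq0 !mulf_eq0 (negPf Jac) (negPf (FC a aC)) (negPf (FC c cC)) !orbF.
  by rewrite -lt0n -has_count; apply/hasP; exists a; rewrite ?eqxx.
(* Since A_w is nonzero, some term of the double sum at d + w must be nonzero. *)
have support w : w \in W ->
    exists y z, [/\ y \in C', z \in C', Jform d y z != 0 & y + z = dvec R d + w].
  move=> wW; have [Aw _ _ _ _] := HW w wW.
  have [/hasP[y yC /hasP[z zC /andP[/eqP yz Jyz]]]|/hasPn no] :=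
    boolP (has (fun y => has (fun z => (y + z == dvec R d + w) && (Jform d y z != 0)) C) C).
    exists y, z; split=> //; rewrite mem_filter ?yC ?zC andbT.
      by apply: contraNneq Jyz => ->; rewrite JC J0.
    by apply: contraNneq Jyz => ->; rewrite J0.
  exfalso; have := supi (dvec R d + w); rewrite big_seq big1.
    rewrite big_mkcond (bigD1_seq w)//= eqxx big1 ?addr0.
      by move/esym/eqP; rewrite (negPf Aw).
    by move=> w' ww'; rewrite (inj_eq (addrI _)) eq_sym (negPf ww').
  move=> y yC; rewrite big_seq_cond big1// => z /andP[zC yz].
  have /hasPn/(_ z zC) := no y yC; rewrite yz negbK => /eqP->.
  by rewrite !mul0r.
apply: (@exponents_level0 R _ C' (Jform d) l JC JD _ _ rule) xC'.
- by move=> y z y' z' e; have := vsumD y z; rewrite e vsumD /l; lra.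
- move=> y z; rewrite /l => /addIr yz nyz; apply: Jform_neg => //.
    by rewrite vN yz subrr.
  by rewrite subr_eq0.
- by rewrite mem_filter eqxx.
- move=> p Jp; apply: (@Jform_span R r d r2 d0 W) => // w /support[y [z [yC zC Jyz <-]]].
  exact: Jp.
Qed.
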